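(* Let $\theta$ be a nonnegative real number. Then there exists an infinite word $\mathbf{w}$ such that $\mathcal{A}(\mathbf{w}) = \theta$, where $\mathcal{A}$ denotes the abelian critical exponent. Moreover, $\mathbf{w}$ can be taken over an alphabet of at most three letters.
   Context: For a finite word $u$ and a letter (or word) $a$, $|u|_a$ denotes the number of occurrences of $a$ in $u$ as a factor. Two finite words $u,v$ are abelian equivalent, written $u\sim v$, if they are permutations of each other. An abelian power of exponent $e$ (a positive integer) and period $m$ is a word of the form $u_0u_1\cdots u_{e-1}$ where $u_0,\dots,u_{e-1}$ are nonempty, pairwise abelian equivalent, and $m=|u_0|$. For an infinite word $\mathbf{w}$ and a positive integer $m$, let $A_{\mathbf{w}}(m)$ be the supremum of the exponents of abelian powers of period $m$ occurring (as factors) in $\mathbf{w}$. The abelian critical exponent of $\mathbf{w}$ is $\mathcal{A}(\mathbf{w}) = \limsup_{m\to\infty} A_{\mathbf{w}}(m)/m$ (a value in $[0,\infty]$). *)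

(* Defs.v *)
From HB Require Import structures.
From mathcomp Require Import all_boot all_order all_algebra.
From mathcomp Require Import all_classical all_reals all_analysis.
Set Implicit Arguments. Unset Strict Implicit. Unset Printing Implicit Defensive.
Import Order.TTheory GRing.Theory Num.Theory.

Definition block {A : Type} (w : nat -> A) (i m k : nat) : seq A :=
  [seq w (i + k * m + j)%N | j <- iota 0 m].

Definition abelian_equiv {A : eqType} (u v : seq A) : bool := perm_eq u v.

Definition abelian_power_at {A : eqType} (w : nat -> A) (i m e : nat) : Prop :=
  (0 < m)%N /\ (0 < e)%N /\
  forall k l, (k < e)%N -> (l < e)%N ->
    abelian_equiv (block w i m k) (block w i m l).

Local Open Scope ereal_scope.

Definition abelian_sup_exp {R : realType} {A : eqType} (w : nat -> A) (m : nat)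
  : \bar R :=
  ereal_sup [set (e%:R)%:E | e in [set e : nat | exists i, abelian_power_at w i m e]].

Definition abelian_critical_exponent {R : realType} {A : eqType} (w : nat -> A)
  : \bar R :=
  limn_esup (fun m : nat => abelian_sup_exp (R := R) w m * ((m%:R)^-1)%:E).

(* Main.v *)
(** Dekking's binary word, the fixed point of 0 -> 011, 1 -> 0001, contains no
    abelian fourth power. With a third letter as marker, let x_M be the word of
    period M made of the marker followed by M - 1 letters of Dekking's word: its
    abelian powers of period m have exponent at most 3 unless M divides m.
    The word w is the concatenation of zones, each a prefix of some x_M of length
    E(M) M, where E(M) = max(8, floor(theta M)) and M exceeds the total length of
    the preceding zones. Then w has abelian powers of period M and exponent E(M)
    for infinitely many M, while any abelian power of period m essentially lives
    in one zone with M <= m plus boundedly many blocks, so that its exponent is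
    at most E(m) + 7. *)
Require Import Defs.
From HB Require Import structures.
From mathcomp Require Import all_boot all_order all_algebra.
From mathcomp Require Import all_classical all_reals all_analysis.
From mathcomp Require Import zify lra.
Set Implicit Arguments. Unset Strict Implicit. Unset Printing Implicit Defensive.
Import Order.TTheory GRing.Theory Num.Theory.

(** * Prefix counts and arithmetic progressions *)

Definition prefix_count (f : nat -> bool) (n : nat) : nat := count f (iota 0 n).

(** For a prefix count [P]: [e] consecutive blocks of length [m] from [s] on contain [g] occurrences
    each. *)
Definition arith_prog (P : nat -> nat) (s m e g : nat) : Prop :=
  forall k, k <= e -> P (s + k * m) = P s + k * g.

Lemma prefix_countS f n : prefix_count f n.+1 = prefix_count f n + f n.
Proof. by rewrite /prefix_count -addn1 iotaD count_cat /= addn0. Qed.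

Lemma prefix_countD f a n :
  prefix_count f (a + n) = prefix_count f a + prefix_count (fun j => f (a + j)) n.
Proof.
elim: n => [|n IHn]; first by rewrite addn0 /prefix_count addn0.
by rewrite addnS !prefix_countS IHn addnA.
Qed.

Lemma leq_prefix_count f a b : a <= b -> prefix_count f a <= prefix_count f b.
Proof. by move=> /subnKC <-; rewrite prefix_countD leq_addr. Qed.

Lemma eq_in_prefix_count f g n :
  (forall j, j < n -> f j = g j) -> prefix_count f n = prefix_count g n.
Proof.
by move=> fg; apply: eq_in_count => j; rewrite mem_iota /= add0n => /fg.
Qed.

Lemma prefix_count_nth (T : eqType) (p : pred T) (x0 : T) (u : seq T) n :
  n <= size u -> prefix_count (fun j => p (nth x0 u j)) n = count p (take n u).
Proof.
elim: n => [|n IHn] lenu; first by rewrite take0.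
by rewrite prefix_countS IHn 1?ltnW // (take_nth x0) // -cats1 count_cat /= addn0.
Qed.

Lemma arith_prog_sub P s m e g a e' :
  arith_prog P s m e g -> a + e' <= e -> arith_prog P (s + a * m) m e' g.
Proof.
move=> Pe le_e k lek; rewrite -addnA -mulnDl !Pe ?mulnDl ?addnA //.
  exact: leq_trans (leq_addr _ _) le_e.
by apply: leq_trans le_e; rewrite leq_add2l.
Qed.

(** * Infinite words as limits of prefix chains *)

Definition limit_word (T : Type) (x0 : T) (L : nat -> seq T) (n : nat) : T :=
  nth x0 (L n.+1) n.

Section Limit.
Variables (T : eqType) (x0 : T) (L : nat -> seq T).
Hypothesis prefixL : forall n, prefix (L n) (L n.+1).
Hypothesis sizeL : forall n, n <= size (L n).

Lemma prefix_chain a b : a <= b -> prefix (L a) (L b).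
Proof.
move=> /subnKC <-; elim: (b - a) => [|d IHd]; first by rewrite addn0 prefix_refl.
by rewrite addnS; apply: prefix_trans IHd (prefixL _).
Qed.

Lemma nth_prefix (u v : seq T) i : prefix u v -> i < size u -> nth x0 v i = nth x0 u i.
Proof. by move=> /prefixP [s ->] iu; rewrite nth_cat iu. Qed.

Lemma limit_wordE n i : i < size (L n) -> limit_word x0 L i = nth x0 (L n) i.
Proof.
move=> iL; have [le|lt] := leqP i.+1 n.
  by rewrite (nth_prefix (prefix_chain le)).
by rewrite /limit_word -(nth_prefix (prefix_chain (ltnW lt)) iL).
Qed.

End Limit.

(** * Dekking's morphism and its fixed point *)

Definition dekking_letter (b : bool) : seq bool :=
  if b then [:: false; false; false; true] else [:: false; true; true].

Definition dekking (u : seq bool) : seq bool := flatten (map dekking_letter u).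

(** Over two letters, the length and the number of [true] determine the abelian class. *)
Definition abelian4_free (u : seq bool) : Prop :=
  forall s m g, 0 < m -> s + 4 * m <= size u ->
    ~ arith_prog (fun n => count id (take n u)) s m 4 g.

(** Both images end in [true]. The case [(0, 0)] is the position just before that last letter,
    counted back from the next image boundary; the other cases are 0, 1 or 2 letters [false] past a
    boundary. *)
Lemma dekking_position u i : i <= size (dekking u) ->
  exists n d e, [/\ n <= size u, (d, e) \in [:: (1, 1); (2, 1); (3, 1); (0, 0)],
    i + 1 = 3 * n + count id (take n u) + d &
    count id (take i (dekking u)) + 1 + count id (take n u) = 2 * n + e].
Proof.
elim: u i => [|b u IHu] i.
  by rewrite leqn0 => /eqP ->; exists 0, 1, 1.
rewrite /dekking /= -/(dekking u) size_cat => lei.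
have [lt|ge] := ltnP i (size (dekking_letter b)).
  rewrite takel_cat ?(ltnW lt) //.
  move: i lt {lei}; case: b => -[|[|[|[|//]]]] // _.
  - by exists 0, 1, 1.
  - by exists 0, 2, 1.
  - by exists 0, 3, 1.
  - by exists 1, 0, 0; rewrite /= take0.
  - by exists 0, 1, 1.
  - by exists 0, 2, 1.
  - by exists 1, 0, 0; rewrite /= take0.
have [|n [d [e [le_n de Ei Ec]]]] := IHu (i - size (dekking_letter b)); first by lia.
exists n.+1, d, e; split => //=.
  by move: ge Ei; case: (b) => /=; lia.
rewrite take_cat ltnNge ge /= count_cat.
by move: Ec; case: (b) => /=; lia.
Qed.

(** The four kinds of position have weights 0, 1, 2, 3 modulo 5, so the residue alone gives the
    place inside an image; residue 3 is the one counted back from the next boundary. *)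
Lemma dekking_position_mod5 u i : i <= size (dekking u) ->
  let C := count id (take i (dekking u)) in
  let r := (i + C) %% 5 in
  exists n, [/\ n <= size u, r <= 3,
    5 * n + r = i + C + (if r == 3 then 5 else 0) &
    i + (r == 3) = 3 * n + count id (take n u) + (if r == 3 then 0 else r)].
Proof.
move=> /dekking_position [n [d [e [le_n]]]].
set C := count id (take i _); set c := count id (take n u).
rewrite !inE => de Ei Ec /=.
have E5 : i + C + 2 = 5 * n + d + e by lia.
have Er : (i + C) %% 5 = if d == 0 then 3 else d.-1.
  by move: de => /or4P [] /eqP [? ?]; subst d e => /=; lia.
rewrite Er.
by exists n; move: de => /or4P [] /eqP [? ?]; subst d e => /=; split; lia.
Qed.

(* Each letter image has weight [0] modulo 5 when [false] weighs 1 and [true]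
   weighs 2, and no proper prefix of an image has weight 4; so the five
   endpoints of a fourth power have the same weight, i.e. sit at the same place
   inside the images, and the power desubstitutes. *)
Lemma dekking_abelian4_free u : abelian4_free u -> abelian4_free (dekking u).
Proof.
move=> free s m g m0 le_s ap.
have pos k : k <= 4 -> exists n, [/\ n <= size u,
    (s + k * m + (count id (take s (dekking u)) + k * g)) %% 5 <= 3 &
    let r := (s + k * m + (count id (take s (dekking u)) + k * g)) %% 5 in
    5 * n + r = s + k * m + (count id (take s (dekking u)) + k * g)
                + (if r == 3 then 5 else 0) /\
    s + k * m + (r == 3) = 3 * n + count id (take n u) + (if r == 3 then 0 else r)].
  move=> k4; have := @dekking_position_mod5 u (s + k * m).
  case; first by nia.
  by move=> n; rewrite ap // => -[]; exists n.
move: {ap} (count id _) pos => C pos.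
have [n0 [_ r0 [E0 F0]]] := pos 0 isT.
have [n1 [_ r1 [E1 F1]]] := pos 1 isT.
have [n2 [_ r2 [E2 F2]]] := pos 2 isT.
have [n3 [_ r3 [E3 F3]]] := pos 3 isT.
have [n4 [N4 r4 [E4 F4]]] := pos 4 isT.
(* Otherwise the five weights would run through all residues modulo 5, including 4. *)
have mg : (m + g) %% 5 = 0 by lia.
have Er k : (s + k * m + (C + k * g)) %% 5 = (s + C) %% 5.
  rewrite (_ : s + k * m + (C + k * g) = s + C + k * (m + g)); last by lia.
  by rewrite -modnDmr -modnMmr mg muln0 mod0n addn0.
rewrite !Er in E0 F0 E1 F1 E2 F2 E3 F3 E4 F4.
set q := (m + g) %/ 5; have Eq : m + g = 5 * q by rewrite /q; lia.
have q0 : 0 < q by lia.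
have En1 : n1 = n0 + q by lia.
have En2 : n2 = n0 + 2 * q by lia.
have En3 : n3 = n0 + 3 * q by lia.
have En4 : n4 = n0 + 4 * q by lia.
(* Each preimage block has length [q] and [m - 3 * q] letters [true]; this makes the subtraction
   exact. *)
have le3 : 3 * q <= m.
  have : count id (take n0 u) <= count id (take n1 u).
    rewrite En1 takeD count_cat; exact: leq_addr.
  by lia.
apply: (free n0 q (m - 3 * q)) => //; first by lia.
move=> [|[|[|[|[|//]]]]] _ /=; rewrite ?mul1n ?addn0 -?En1 -?En2 -?En3 -?En4; lia.
Qed.

Definition dekking_iter (n : nat) : seq bool := iter n dekking [:: false].

Definition dekking_word : nat -> bool := limit_word false dekking_iter.

Lemma dekking_cat u v : dekking (u ++ v) = dekking u ++ dekking v.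
Proof. by rewrite /dekking map_cat flatten_cat. Qed.

Lemma size_dekking u : 3 * size u <= size (dekking u).
Proof.
elim: u => //= b u IHu; rewrite /dekking /= -/(dekking u) size_cat.
by case: b => /=; lia.
Qed.

Lemma dekking_iter_prefix n : prefix (dekking_iter n) (dekking_iter n.+1).
Proof.
elim: n => [//|n /prefixP [s Es]].
by rewrite /dekking_iter !iterS in Es *; rewrite [in X in prefix _ X]Es dekking_cat prefix_prefix.
Qed.

Lemma dekking_iter_size n : n < size (dekking_iter n).
Proof.
elim: n => //= n IHn; have := size_dekking (dekking_iter n).
by rewrite /dekking_iter in IHn *; lia.
Qed.

Lemma dekking_iter_abelian4_free n : abelian4_free (dekking_iter n).
Proof.
elim: n => [|n IHn]; last exact: dekking_abelian4_free.
by move=> s m g m0 /=; lia.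
Qed.

Lemma dekking_word_abelian4_free s m g :
  0 < m -> ~ arith_prog (prefix_count dekking_word) s m 4 g.
Proof.
move=> m0 ap; have [N EN] : exists N, N = s + 4 * m by exists (s + 4 * m).
have N0 := dekking_iter_size N.
apply: (@dekking_iter_abelian4_free N s m g m0); first by rewrite -EN ltnW.
have Ec n : n <= N -> prefix_count dekking_word n = count id (take n (dekking_iter N)).
  move=> nN; have nL : n <= size (dekking_iter N) by apply: leq_trans nN (ltnW N0).
  rewrite -(prefix_count_nth id false nL).
  apply: eq_in_prefix_count => j jn.
  apply: (limit_wordE false dekking_iter_prefix) => [n'|].
    exact: ltnW (dekking_iter_size _).
  by apply: ltn_trans N0; apply: leq_trans nN.
move=> k k4; have le_k : s + k * m <= N by rewrite EN leq_add2l leq_mul2r k4 orbT.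
by rewrite -(Ec _ le_k) ap // Ec // EN leq_addr.
Qed.

(** * Periodic words with a marker *)

Definition letter (k : nat) : 'I_3 := inord k.

Definition marker : 'I_3 := letter 2.

Definition marked_word (M t : nat) : 'I_3 :=
  if M %| t then marker else letter (dekking_word (t %% M)).

Definition letter_count (w : nat -> 'I_3) (c : 'I_3) : nat -> nat :=
  prefix_count (fun j => w j == c).

Lemma letter_eq a b : a < 3 -> b < 3 -> (letter a == letter b) = (a == b).
Proof. by move=> a3 b3; rewrite -val_eqE /= !inordK. Qed.

Lemma marked_wordMD M q t : marked_word M (q * M + t) = marked_word M t.
Proof. by rewrite /marked_word dvdn_addr ?dvdn_mull // modnMDl. Qed.

Lemma marked_countMD M c q n :
  letter_count (marked_word M) c (q * M + n) =
  q * letter_count (marked_word M) c M + letter_count (marked_word M) c n.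
Proof.
elim: q => [|q IHq]; first by rewrite !mul0n.
rewrite mulSn -addnA /letter_count prefix_countD -/(letter_count _ c).
rewrite (_ : prefix_count _ (q * M + n) = letter_count (marked_word M) c (q * M + n)).
  by rewrite IHq mulSn addnA.
apply: eq_in_prefix_count => j _.
by have := marked_wordMD M 1 j; rewrite mul1n => ->.
Qed.

(** The quotient is the ceiling of [n / M]: markers sit at the multiples of [M]. *)
Lemma marked_count_marker M n :
  0 < M -> letter_count (marked_word M) marker n = (n + M.-1) %/ M.
Proof.
move=> M0; elim: n => [|n IHn].
  by rewrite add0n divn_small // prednK.
rewrite /letter_count prefix_countS -/(letter_count _ _ n) IHn addSn divnS //.
rewrite addnC; congr (nat_of_bool _ + _).
rewrite -addnS prednK // dvdn_addl // /marked_word.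
case: (M %| n); first exact: eqxx.
by rewrite /marker letter_eq //; case: dekking_word.
Qed.

Lemma marked_count_dekking M b : 0 < b <= M ->
  letter_count (marked_word M) (letter 1) b + dekking_word 0
  = prefix_count dekking_word b.
Proof.
case: b => // b /= bM; rewrite -(add1n b) /letter_count !prefix_countD.
have P1 f : prefix_count f 1 = f 0 by rewrite prefix_countS.
rewrite !P1 {1}/marked_word dvdn0 /marker letter_eq // add0n addnC; congr (_ + _).
apply: eq_in_prefix_count => j jb.
have jM : 1 + j < M by apply: leq_trans bM.
rewrite /marked_word modn_small // gtnNdvd //.
by case: dekking_word; rewrite letter_eq.
Qed.

(** A window without marker stays inside one period, behind its marker, where counts agree with
    Dekking's word up to a constant. *)
Lemma marked_gap M s d g : 0 < M -> 0 < d ->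
  letter_count (marked_word M) marker (s + 4 * d)
    = letter_count (marked_word M) marker s ->
  ~ arith_prog (letter_count (marked_word M) (letter 1)) s d 4 g.
Proof.
move=> M0 d0; rewrite !marked_count_marker // => Eg ap.
have [q [a [Es a0 aM]]] : exists q a, [/\ s = q * M + a, 0 < a & a + 4 * d <= M].
  case: s Eg {ap} => [|s] Eg.
    move: Eg; rewrite !add0n (divn_small (_ : M.-1 < M)) ?prednK // => /eqP.
    by rewrite -leqn0 leqNgt divn_gt0 // => /negP []; lia.
  exists (s %/ M), (s %% M).+1; split => //; first by rewrite addnS -divn_eq.
  move: Eg; rewrite !addSn (_ : (s + 4 * d + M.-1).+1 = s + 4 * d + M); last by lia.
  rewrite (_ : (s + M.-1).+1 = s + M); last by lia.
  have EM x : (x + M) %/ M = x %/ M + 1 by rewrite divnDr // divnn M0.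
  rewrite !EM => /eqP; rewrite eqn_add2r => /eqP Eg.
  have := ltn_pmod (s + 4 * d) M0; have := divn_eq (s + 4 * d) M.
  rewrite Eg; have := divn_eq s M; lia.
apply: (@dekking_word_abelian4_free a d g d0) => k k4.
have le_k : k * d <= 4 * d by rewrite leq_mul2r k4 orbT.
have := ap _ k4; rewrite Es -addnA !marked_countMD.
have := @marked_count_dekking M (a + k * d); have := @marked_count_dekking M a.
lia.
Qed.

(* Reducing the period [m] modulo [M] leaves a step [d < M], so each block has
   at most one marker. Without a marker the blocks lie in a factor of the
   Dekking word; with one each, the complementary windows of length [M - d],
   read backwards, do. *)
Lemma marked_abelian4 M s m : 0 < M ->
  (forall c, exists g, arith_prog (letter_count (marked_word M) c) s m 4 g) ->
  M %| m.
Proof.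
move=> M0 ap; rewrite /dvdn; set d := m %% M; set q := m %/ M.
have [//|d0] := posnP d.
have dM : d < M by apply: ltn_pmod.
have Em : m = q * M + d by apply: divn_eq.
have apd c : exists2 g, arith_prog (letter_count (marked_word M) c) s d 4 g &
    g <= letter_count (marked_word M) c M.
  have [g apg] := ap c; set T := letter_count (marked_word M) c M.
  have Pk k : k <= 4 ->
      letter_count (marked_word M) c (s + k * d) + k * q * T
      = letter_count (marked_word M) c s + k * g.
    move=> k4; rewrite -apg // Em mulnDr mulnA.
    by rewrite (addnC (k * q * M)) addnA [in RHS]addnC marked_countMD addnC.
  have le0 : letter_count (marked_word M) c s <= letter_count (marked_word M) c (s + d).
    exact: leq_prefix_count (leq_addr _ _).
  have le1 : letter_count (marked_word M) c (s + d) <= letter_count (marked_word M) c s + T.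
    apply: leq_trans (leq_prefix_count _ (_ : _ <= 1 * M + s)) _; first by lia.
    by rewrite -/(letter_count _ _ _) marked_countMD mul1n addnC.
  have := Pk 1 isT; rewrite !mul1n => E1.
  (* A block of length [q * M + d] has [q * T] more occurrences than one of length [d]. *)
  exists (g - q * T); last by lia.
  move=> k k4; have := Pk k k4.
  have : q * T <= g by lia.
  rewrite mulnBr mulnA => ?.
  by have : k * q * T <= k * g; [rewrite -mulnA leq_mul2l; lia | lia].
have [g1 ap1 _] := apd (letter 1); have [g2 ap2 le2] := apd marker.
have T2 : letter_count (marked_word M) marker M = 1.
  by rewrite marked_count_marker // divnDl // divnn M0 divn_small // prednK.
rewrite T2 in le2; exfalso; have [E2|g20] := posnP g2.
  by apply: (@marked_gap M s d g1) => //; rewrite ap2 // E2 muln0 addn0.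
have {le2 g20} E2 : g2 = 1 by lia.
have compl c g : arith_prog (letter_count (marked_word M) c) s d 4 g ->
    g <= letter_count (marked_word M) c M ->
    arith_prog (letter_count (marked_word M) c) (s + 4 * d) (M - d) 4
      (letter_count (marked_word M) c M - g).
  move=> apg le_g k k4; rewrite apg //.
  (* The old endpoints in reverse order, the [k]-th moved right by [k] periods. *)
  rewrite (_ : s + 4 * d + k * (M - d) = k * M + (s + (4 - k) * d)).
    rewrite marked_countMD apg ?leq_subr // mulnBr mulnBl.
    have : k * g <= k * letter_count (marked_word M) c M by rewrite leq_mul2l le_g orbT.
    have : k * g <= 4 * g by rewrite leq_mul2r k4 orbT.
    lia.
  have : k * d <= k * M by rewrite leq_mul2l (ltnW dM) orbT.
  have : k * d <= 4 * d by rewrite leq_mul2r k4 orbT.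
  by rewrite mulnBr mulnBl; lia.
have [g apg leg] := apd (letter 1).
apply: (marked_gap M0 _ _ (compl _ _ apg leg)); first by rewrite subn_gt0.
have le1 : g2 <= letter_count (marked_word M) marker M by rewrite T2 E2.
by rewrite (compl _ _ ap2 le1 4) // T2 E2 subnn muln0 addn0.
Qed.

(** Abelian powers through prefix counts; exponent 0 is allowed so that subpowers need no side
    condition. *)
Definition count_power (w : nat -> 'I_3) (i m e : nat) : Prop :=
  forall c, exists g, arith_prog (letter_count w c) i m e g.

Lemma count_power_sub w i m e a e' :
  count_power w i m e -> a + e' <= e -> count_power w (i + a * m) m e'.
Proof. by move=> pw le c; have [g /arith_prog_sub] := pw c; exists g; auto. Qed.

(** * Splicing the zones *)

Section Stages.
Variable E : nat -> nat.

Fixpoint stage (j : nat) : seq 'I_3 :=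
  if j is j'.+1 then
    let W := stage j' in
    W ++ mkseq (marked_word (size W).+1) (E (size W).+1 * (size W).+1)
  else [::].

Definition spliced_word : nat -> 'I_3 := limit_word marker stage.

Hypothesis E_ge8 : forall m, 8 <= E m.
Hypothesis E_mono : {homo E : m n / m <= n}.

Lemma stage_prefix j : prefix (stage j) (stage j.+1).
Proof. exact: prefix_prefix. Qed.

Lemma size_stageS j :
  size (stage j.+1) = size (stage j) + E (size (stage j)).+1 * (size (stage j)).+1.
Proof. by rewrite /= size_cat size_mkseq. Qed.

Lemma size_stage_lt j : size (stage j) < size (stage j.+1).
Proof. by rewrite size_stageS; have := E_ge8 (size (stage j)).+1; nia. Qed.

Lemma size_stage j : j <= size (stage j).
Proof. by elim: j => // j IHj; apply: leq_ltn_trans IHj (size_stage_lt j). Qed.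

Lemma spliced_count j c t : let M := (size (stage j)).+1 in t <= E M * M ->
  letter_count spliced_word c (size (stage j) + t) =
  letter_count spliced_word c (size (stage j)) + letter_count (marked_word M) c t.
Proof.
move=> M tM; rewrite /letter_count prefix_countD; congr (_ + _).
apply: eq_in_prefix_count => i it; congr (_ == _).
rewrite /spliced_word (@limit_wordE _ _ _ stage_prefix size_stage j.+1).
  by rewrite /= nth_cat ltnNge leq_addr addKn nth_mkseq // (leq_trans it).
by rewrite size_stageS ltn_add2l (leq_trans it).
Qed.

Lemma spliced_power j : let M := (size (stage j)).+1 in
  count_power spliced_word (size (stage j)) M (E M).
Proof.
move=> M c; exists (letter_count (marked_word M) c M) => k kE.
rewrite spliced_count ?leq_mul2r ?kE ?orbT // -[k * M]addn0 marked_countMD.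
by rewrite (_ : letter_count _ c 0 = 0) // addn0.
Qed.

(** Exponent 4 or more forces the zone's period [M] to divide [m]; then [e * m <= E M * M] and
    [M <= m] give [e <= E M <= E m]. *)
Lemma spliced_zone_bound j i m e :
  0 < m -> size (stage j) <= i -> i + e * m <= size (stage j.+1) ->
  count_power spliced_word i m e ->
  e <= 3 \/ size (stage j) < m /\ e <= E m.
Proof.
rewrite size_stageS; set S := size (stage j); set M := S.+1.
move=> m0 iS ie pw; have [|e4] := leqP e 3; [by left | right].
have dvM : M %| m.
  apply: (@marked_abelian4 M (i - S)) => // c; have [g ap] := pw c.
  exists g => k k4; have := ap k (leq_trans k4 e4).
  have le_k : k * m <= e * m by rewrite leq_mul2r (leq_trans k4 e4) orbT.
  have := @spliced_count j c (i - S + k * m); have := @spliced_count j c (i - S).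
  rewrite -/S -/M addnA subnKC //; lia.
have Mm : M <= m by apply: dvdn_leq.
split=> //; apply: leq_trans (E_mono Mm).
rewrite -(leq_pmul2r m0); apply: leq_trans (_ : E M * M <= _); first by lia.
by rewrite leq_mul2l Mm orbT.
Qed.

(** Cuts a power at a zone boundary [B]: at most the block before the cut straddles it. *)
Lemma split_at B i m : 0 < m -> exists2 k, B <= i + k * m &
  k = 0 \/ 0 < k /\ i + k.-1 * m < B.
Proof.
move=> m0; have exk : exists k, B <= i + k * m by exists B; nia.
exists (ex_minn exk); case: ex_minnP => // -[|k] Bk mink; [by left | right].
by split=> //=; rewrite ltnNge; apply/negP => /mink; rewrite ltnn.
Qed.

(* Let [J] be the last zone met by the power. Either [m] exceeds everything
   before [J], or zone [J] holds at most three blocks and the rest lies in zone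
   [J.-1], up to a single block: crossing that zone entirely with a period
   [m] at most [size (stage J.-1)] would put more than three blocks inside. *)
Lemma spliced_exponent_bound i m e :
  0 < m -> count_power spliced_word i m e -> e <= E m + 7.
Proof.
move=> m0 pw; have [|e0] := leqP e 0; first by lia.
have exJ : exists J, i + e * m <= size (stage J) by exists (i + e * m); apply: size_stage.
case: (ex_minnP exJ) => -[|J] leJ minJ; first by move: leJ => /=; nia.
have {exJ minJ} gtJ : size (stage J) < i + e * m.
  by rewrite ltnNge; apply/negP => /minJ; rewrite ltnn.
have E8 := E_ge8 m.
have [k2 Sk2 k2P] := split_at (size (stage J)) i m0.
have k2e : k2 <= e.
  rewrite leqNgt; apply/negP => ?.
  by have : e * m <= k2.-1 * m; [rewrite leq_mul2r; lia | lia].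
have bJ : e - k2 <= 3 \/ size (stage J) < m /\ e - k2 <= E m.
  apply: (@spliced_zone_bound J (i + k2 * m)) => //.
    by rewrite -addnA -mulnDl subnKC.
  by apply: count_power_sub pw _; rewrite subnKC.
have [mJ|Jm] := ltnP (size (stage J)) m.
  suff : k2 <= 1 by lia.
  rewrite leqNgt; apply/negP => ?.
  by have : 1 * m <= k2.-1 * m; [rewrite leq_mul2r; lia | lia].
have {bJ} bJ : e - k2 <= 3 by lia.
have [|k20] := leqP k2 0; first by lia.
have {k2P} k2P : i + k2.-1 * m < size (stage J) by lia.
case: J => [|J] in leJ gtJ Sk2 k2P Jm *; first by rewrite /= in k2P.
have [k1 Sk1 k1P] := split_at (size (stage J)) i m0.
have bJ' : k2.-1 - k1 <= 3 \/ size (stage J) < m /\ k2.-1 - k1 <= E m.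
  have [k12|k21] := leqP k1 k2.-1; last by left; lia.
  apply: (@spliced_zone_bound J (i + k1 * m)) => //.
    by rewrite -addnA -mulnDl subnKC // ltnW.
  by apply: count_power_sub pw _; lia.
have [mJ|{}Jm] := ltnP (size (stage J)) m.
  suff : k1 <= 1 by lia.
  rewrite leqNgt; apply/negP => ?.
  by have : 1 * m <= k1.-1 * m; [rewrite leq_mul2r; lia | lia].
have {bJ'} bJ' : k2.-1 - k1 <= 3 by lia.
case: k1P => [?|[k10 k1P]]; first by lia.
(* The zone is longer than [8 * m], as its period exceeds [m], yet fewer than six blocks span it. *)
exfalso; move: Sk2; rewrite size_stageS leqNgt => /negP [].
have : 8 * m <= E (size (stage J)).+1 * (size (stage J)).+1 by apply: leq_mul => //; lia.
have : k2 * m <= (k1.-1 + 6) * m by rewrite leq_mul2r; lia.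
by rewrite mulnDl; lia.
Qed.

End Stages.

(** * From block permutations to prefix counts *)

Lemma count_block (w : nat -> 'I_3) i m k c :
  (letter_count w c (i + k.+1 * m)
   = letter_count w c (i + k * m) + count_mem c (block w i m k))%N.
Proof.
rewrite mulSn addnCA addnC {1}/letter_count prefix_countD count_map.
by congr (_ + _)%N; apply: eq_count => j.
Qed.

Lemma abelian_powerP (w : nat -> 'I_3) i m e :
  abelian_power_at w i m e <-> [/\ (0 < m)%N, (0 < e)%N & count_power w i m e].
Proof.
split=> [[m0 [e0 eqb]]|[m0 e0 pw]]; split=> //.
  move=> c; exists (count_mem c (block w i m 0)).
  elim=> [|k IHk] ke; first by rewrite !mul0n !addn0.
  rewrite count_block IHk 1?ltnW // mulSn addnCA addnC; congr (_ + _)%N.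
  exact: (permP (eqb _ _ ke e0)).
split=> // k l ke le; apply/allP => c _ /=; have [g ap] := pw c.
have Eg n : (n < e)%N -> count_mem c (block w i m n) = g.
  move=> ne; have := count_block w i m n c; rewrite (ap _ ne) (ap _ (ltnW ne)).
  by rewrite mulSn addnCA addnC => /addnI.
by rewrite !Eg.
Qed.

(** * The upper limit and the choice of exponents *)

Local Open Scope ring_scope.

(** The upper limit is the infimum of the suprema of tails: one tail bounds it above, a term in
    every tail bounds it below. *)
Lemma limn_esup_eqP (R : realType) (u : nat -> \bar R) (x : R) :
  (forall eps, 0 < eps -> exists N, forall m, (N <= m)%N -> (u m <= (x + eps)%:E)%E) ->
  (forall eps N, 0 < eps -> exists2 m, (N <= m)%N & ((x - eps)%:E <= u m)%E) ->
  limn_esup u = x%:E.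
Proof.
move=> ub lb; rewrite limn_esup_lim (cvg_lim _ (@cvg_esups_inf _ u)) //.
apply/eqP; rewrite eq_le; apply/andP; split.
  apply/lee_addgt0Pr => eps eps0; have [N uN] := ub _ eps0.
  apply: (@le_trans _ _ (esups u N)); first by apply: ereal_inf_lbound; exists N.
  by apply: ge_ereal_sup => _ [m /= Nm <-]; rewrite -EFinD; apply: uN.
apply: le_ereal_inf_tmp => _ [N _ <-].
apply/lee_subgt0Pr => eps eps0; have [m Nm um] := lb _ N eps0.
by apply: (le_trans um); apply: ereal_sup_ubound; exists m.
Qed.

Definition zone_exponent (R : realType) (theta : R) (m : nat) : nat :=
  maxn 8 (Num.truncn (theta * m%:R)).

Lemma zone_exponent_homo (R : realType) (theta : R) :
  0 <= theta -> {homo zone_exponent theta : m n / (m <= n)%N}.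
Proof.
move=> th0 m n mn; rewrite /zone_exponent geq_max leq_maxl leq_max.
by rewrite le_truncn ?orbT // ler_wpM2l // ler_nat.
Qed.

Lemma zone_exponent_le (R : realType) (theta : R) m :
  0 <= theta -> (zone_exponent theta m)%:R <= theta * m%:R + 8.
Proof.
move=> th0; have tm0 : 0 <= theta * m%:R by rewrite mulr_ge0.
have := truncn_le (theta * m%:R); rewrite tm0 /zone_exponent /maxn => tr.
by case: ifP => _; lra.
Qed.

Lemma zone_exponent_ge (R : realType) (theta : R) m :
  0 <= theta -> theta * m%:R - 1 <= (zone_exponent theta m)%:R.
Proof.
move=> th0; have tm0 : 0 <= theta * m%:R by rewrite mulr_ge0.
have /andP[_] := truncn_itv tm0; rewrite -natr1 => tr.
have : (Num.truncn (theta * m%:R))%:R <= (zone_exponent theta m)%:R :> R.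
  by rewrite ler_nat leq_maxr.
by lra.
Qed.

(* Every theta >= 0 is the abelian critical exponent of some infinite word
   over a (at most) three-letter alphabet 'I_3. *)
Theorem theorem1 (R : realType) (theta : R) (htheta : 0 <= theta) :
  exists w : nat -> 'I_3, abelian_critical_exponent w = (theta%:E)%E.
Proof.
have E8 m : (8 <= zone_exponent theta m)%N by rewrite leq_maxl.
have Eh := zone_exponent_homo htheta.
pose w := spliced_word (zone_exponent theta); exists w.
apply: limn_esup_eqP => [eps eps0|eps N eps0].
  (* 15 = 8 + 7: the excess of [zone_exponent] over [theta * m], plus that of
     [spliced_exponent_bound]. *)
  exists (Num.truncn (15 / eps)).+1 => m Nm.
  have m0 : 0 < m%:R :> R by rewrite ltr0n; apply: leq_trans Nm.
  have em : 15 <= eps * m%:R.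
    have : 15 / eps < m%:R.
      by apply: lt_le_trans (truncnS_gt _) _; rewrite ler_nat.
    by rewrite ltr_pdivrMr // mulrC => /ltW.
  rewrite lee_pdivrMr // -EFinM; apply: ge_ereal_sup => _ [e [i /abelian_powerP[m0' e0 pw]] <-].
  have le_e := spliced_exponent_bound E8 Eh m0' pw.
  rewrite lee_fin; have := zone_exponent_le m htheta.
  have : e%:R <= (zone_exponent theta m + 7)%:R :> R by rewrite ler_nat.
  by rewrite natrD mulrDl; lra.
(* [M > j] yields [N <= M] and [1 <= eps * M], which absorbs the loss from truncation. *)
pose j := maxn N (Num.truncn eps^-1); pose M := (size (stage (zone_exponent theta) j)).+1.
have jM : (j < M)%N by rewrite ltnS; apply: size_stage.
exists M; first by apply: leq_trans (ltnW jM); rewrite leq_maxl.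
have eM : 1 <= eps * M%:R.
  have : eps^-1 < M%:R.
    apply: lt_le_trans (truncnS_gt _) _; rewrite ler_nat.
    by apply: leq_ltn_trans jM; rewrite leq_maxr.
  by rewrite -[eps^-1]mul1r ltr_pdivrMr // mulrC => /ltW.
rewrite lee_pdivlMr ?ltr0n // -EFinM.
apply: (@le_trans _ _ (zone_exponent theta M)%:R%:E).
  by rewrite lee_fin; have := zone_exponent_ge M htheta; rewrite mulrBl; lra.
apply: ereal_sup_ubound; exists (zone_exponent theta M) => //=.
exists (size (stage (zone_exponent theta) j)); apply/abelian_powerP.
split=> //; first exact: leq_trans (E8 M).
exact: spliced_power.
Qed.
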